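(* Let $R$ be a nil-reversible ring. Then the Dorroh extension $R\bigoplus_D\mathbb{Z}$ of $R$ by $\mathbb{Z}$ is nil-reversible.
   Context: All rings are associative with identity. For a ring $R$, $N(R)$ denotes the set of all nilpotent elements of $R$. For $a\in R$, $l(a)=\{x\in R: xa=0\}$ and $r(a)=\{x\in R: ax=0\}$. A ring $R$ is nil-reversible if $l(a)=r(a)$ for every $a\in N(R)$. For an algebra $A$ (not necessarily with identity) over a commutative ring $C$, the Dorroh extension $A\bigoplus_D C$ of $A$ by $C$ is the set $A\times C$ with operations $(a_1,s_1)+(a_2,s_2)=(a_1+a_2,s_1+s_2)$ and $(a_1,s_1)(a_2,s_2)=(a_1a_2+s_1a_2+s_2a_1,\,s_1s_2)$ for $a_i\in A$, $s_i\in C$. Here $R$ is regarded as a $\mathbb{Z}$-algebra in the usual way. *)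

(* Defs.v *)
From HB Require Import structures.
From mathcomp Require Import all_boot all_order all_algebra.

Set Implicit Arguments.
Unset Strict Implicit.
Unset Printing Implicit Defensive.

Import GRing.Theory.
Local Open Scope ring_scope.

Definition nilpotent_elt (R : pzRingType) (a : R) : Prop :=
  exists2 n : nat, (0 < n)%N & a ^+ n = 0.

Definition lann (R : pzRingType) (a : R) : pred R := [pred x | x * a == 0].

Definition rann (R : pzRingType) (a : R) : pred R := [pred x | a * x == 0].

Definition nil_reversible (R : pzRingType) : Prop :=
  forall a : R, nilpotent_elt a -> lann a =i rann a.

(* The Dorroh extension of R by int: the additive group is that of R * int,
   but the multiplication is not the componentwise one, so this is an alias
   which inherits only the zmodType structure of the product.  The integers
   act on R by x *~ s, the usual int-algebra structure. *)
Definition dorroh (R : Type) : Type := (R * int)%type.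

Section DorrohRing.
Variable R : pzRingType.

Definition dorroh_one : dorroh R := (0, 1).

Definition dorroh_mul (u v : dorroh R) : dorroh R :=
  (u.1 * v.1 + v.1 *~ u.2 + u.1 *~ v.2, u.2 * v.2).

HB.instance Definition _ := GRing.Zmodule.copy (dorroh R) (R * int)%type.

Fact dorroh_mulA : associative dorroh_mul.
Proof.
move=> [a r] [b s] [c t]; congr (_, _) => /=; last exact: mulrA.
rewrite !mulrDl !mulrDr !mulrzDl !mulrzAl !mulrzAr !mulrA -!mulrzA.
rewrite (mulrC s r) (mulrC t r) !addrA.
by rewrite [LHS](ACl (1*4*2*5*3*6*7)).
Qed.

Fact dorroh_mul1r : left_id dorroh_one dorroh_mul.
Proof.
by move=> [a s]; rewrite /dorroh_mul /= mul0r mul0rz add0r addr0 mul1r.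
Qed.

Fact dorroh_mulr1 : right_id dorroh_one dorroh_mul.
Proof.
by move=> [a s]; rewrite /dorroh_mul /= mulr0 mul0rz !add0r mulr1.
Qed.

Fact dorroh_mulDl : left_distributive dorroh_mul +%R.
Proof.
move=> [a r] [b s] [c t]; congr (_, _) => /=; last exact: mulrDl.
rewrite mulrDl mulrzDr mulrzDl !addrA.
by rewrite [LHS](ACl (1*3*5*2*4*6)).
Qed.

Fact dorroh_mulDr : right_distributive dorroh_mul +%R.
Proof.
move=> [a r] [b s] [c t]; congr (_, _) => /=; last exact: mulrDr.
rewrite mulrDr mulrzDr mulrzDl !addrA.
by rewrite [LHS](ACl (1*3*5*2*4*6)).
Qed.

HB.instance Definition _ := GRing.Zmodule_isPzRing.Build (dorroh R)
  dorroh_mulA dorroh_mul1r dorroh_mulr1 dorroh_mulDl dorroh_mulDr.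

End DorrohRing.

Lemma dorroh_addE (R : pzRingType) (u v : dorroh R) :
  u + v = (u.1 + v.1, u.2 + v.2).
Proof. by []. Qed.

Lemma dorroh_mulE (R : pzRingType) (u v : dorroh R) :
  u * v = (u.1 * v.1 + v.1 *~ u.2 + u.1 *~ v.2, u.2 * v.2).
Proof. by []. Qed.

(* Main.v *)
Require Import Defs.
From mathcomp Require Import all_boot all_order all_algebra.

(** Since [int] is reduced, a nilpotent element of the Dorroh extension has the
    form [(a, 0)] with [a] nilpotent in [R] ([dorroh_nilpotent]).  The ring [R]
    has a unit, so [(x, t) |-> x + t%:~R] is a ring morphism onto [R], and
    multiplying by [(a, 0)] on either side only sees this image of the other
    factor ([dorroh_mulr_inl], [dorroh_mull_inl]).  Hence [(x, t)] annihilates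
    [(a, 0)] on a given side iff [x + t%:~R] annihilates [a] on that side, and
    the two sides agree because [R] is nil-reversible. *)

Import GRing.Theory.
Local Open Scope ring_scope.

Lemma dorroh_mulr_inl (R : pzRingType) (u : dorroh R) (a : R) :
  u * ((a, 0) : dorroh R) = ((u.1 + u.2%:~R) * a, 0).
Proof. by rewrite dorroh_mulE /= mulr0z addr0 mulr0 mulrDl mulrzl. Qed.

Lemma dorroh_mull_inl (R : pzRingType) (u : dorroh R) (a : R) :
  ((a, 0) : dorroh R) * u = (a * (u.1 + u.2%:~R), 0).
Proof. by rewrite dorroh_mulE /= mulr0z addr0 mul0r mulrDr mulrzr. Qed.

Lemma dorroh_exp_snd (R : pzRingType) (u : dorroh R) (n : nat) :
  (u ^+ n).2 = u.2 ^+ n.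
Proof. by elim: n => [|n IHn] //; rewrite !exprS dorroh_mulE /= IHn. Qed.

(** The exponent is positive because the unit [(0, 1)] of the extension is not
    of the form [(b, 0)]. *)
Lemma dorroh_exp_inl (R : pzRingType) (a : R) (n : nat) :
  ((a, 0) : dorroh R) ^+ n.+1 = (a ^+ n.+1, 0).
Proof.
elim: n => [|n IHn]; first by rewrite !expr1.
by rewrite exprS IHn dorroh_mulr_inl /= addr0 -exprS.
Qed.

Lemma dorroh_nilpotent (R : pzRingType) (u : dorroh R) :
  nilpotent_elt u -> u.2 = 0 /\ nilpotent_elt u.1.
Proof.
case=> [[|n]] // _ un0.
have u20 : u.2 = 0.
  by apply/eqP; have := dorroh_exp_snd R u n.+1;
     rewrite un0 => /esym/eqP; rewrite expf_eq0.
split=> //; exists n.+1 => //.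
case: u u20 un0 => a s /= ->.
by rewrite dorroh_exp_inl => -[].
Qed.

Theorem proposition2p13 (R : pzRingType) (hR : nil_reversible R) :
  nil_reversible (dorroh R).
Proof.
move=> [a s] /dorroh_nilpotent [/= -> nil_a] u.
rewrite !inE dorroh_mulr_inl dorroh_mull_inl.
have := hR a nil_a (u.1 + u.2%:~R); rewrite !inE => annE.
(* Equality of pairs is decided componentwise, and the second component is 0
   on both sides. *)
by rewrite -[LHS]/((_ == 0) && _) -[RHS]/((_ == 0) && _) annE.
Qed.
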